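(* For $S\subseteq\{1,\dots,n_p\}$ let $J^S=\prod_{i\in S}\{1,\dots,j_i\}$. Let $(\tau^{ij},\pi^{ij})\in\mathbb R^{n_i+1}$ be such that $\tau^{ij}-(\pi^{ij})^\top x_i\ge0$ is valid for $P_i$ and $F_{ij}=\{x_i\in P_i\mid\tau^{ij}-(\pi^{ij})^\top x_i\le0\}$. For $k\in\{1,\dots,n_p\}$ the following system in $(x,y)$ and $\gamma^{S,s}$ ($S\subseteq\{1,\dots,n_p\}$, $|S|=k$, $s\in J^S$) defines a (level $k$) nonlinear relaxation $\mathrm{FDR}^k$ of $\mathrm{FD}$: $$\gamma^{S,s}(-c+Bx+Dy)\le_{\bar K}0\quad\forall S,\ |S|=k,\ s\in J^S,$$ $$\sum_{s\in J^S}\gamma^{S,s}(1;x;y)=(1;x;y)\quad\forall S,\ |S|=k,$$ $$\gamma^{S,s}x_{i'}\in\gamma^{S,s}P_{i'}\quad\forall S,\ |S|=k,\ s\in J^S,\ i'\in\{1,\dots,n_p\},$$ $$\gamma^{S,s}\bigl(\tau^{is_i}-(\pi^{is_i})^\top x_i\bigr)\le0\quad\forall S,\ |S|=k,\ i\in S,\ s\in J^S,$$ $$\gamma^{S,s}\ge0\quad\forall S,\ |S|=k,\ s\in J^S.$$ If $F_{ij}$ and $F_{ij'}$ do not share vertices for all $i$ and $j\neq j'$, then $\gamma^{S,s}$ can be restricted to be the indicator of $F^{S,s}$. Let $\underline{\mathrm{FDR}}^k$ denote the linear relaxation obtained by substituting $\gamma^{S,s}x$ with a variable $u^{S,s}$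 and $\gamma^{S,s}y$ with a variable $w^{S,s}$, viewed as a set in the space of $(x,y)$. Then $$\underline{\mathrm{FDR}}^1\supseteq\cdots\supseteq\underline{\mathrm{FDR}}^{n_p}=\mathrm{conv}(\mathrm{FD}).$$
   Context: Facial disjunctive set: $$\mathrm{FD}=\Bigl\{(x,y)\ \Big|\ Bx+Dy\le_{\bar K}c,\ x_i\in\bigcup_{j=1}^{j_i}F_{ij},\ i=1,\dots,n_p\Bigr\},$$ where $x=(x_1;\dots;x_{n_p})$ with $x_i\in\mathbb R^{n_i}$, $n=\sum_in_i$, $y\in\mathbb R^{n_y}$, $F_{i1},\dots,F_{ij_i}$ are disjoint faces of a polytope $P_i\subset\mathbb R^{n_i}$, $\bar K\subseteq\mathbb R^{m_k}$ is a convex cone, $a\le_{\bar K}a'$ means $a'-a\in\bar K$, $B\in\mathbb R^{m_k\times n}$, $D\in\mathbb R^{m_k\times n_y}$, $c\in\mathbb R^{m_k}$. For $s=(s_i)_{i\in S}\in J^S$, $$F^{S,s}=\Bigl\{x\ \Big|\ x_i\in F_{is_i}\ (i\in S),\ x_i\in\bigcup_{j=1}^{j_i}F_{ij}\ (i\notin S)\Bigr\}.$$ $0P_{i}=\{0\}$. In the linearized system the second constraint reads $\sum_{s\in J^S}(\gamma^{S,s};u^{S,s};w^{S,s})=(1;x;y)$, the first reads $-c\gamma^{S,s}+Bu^{S,s}+Dw^{S,s}\le_{\bar K}0$, the third $u^{S,s}_{i'}\in\gamma^{S,s}P_{i'}$ and the fourth $\gamma^{S,s}\tau^{is_i}-(\pi^{is_i})^\top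 u^{S,s}_i\le0$; $\underline{\mathrm{FDR}}^k$ is the set of $(x,y)$ for which $(\gamma^{S,s},u^{S,s},w^{S,s})$ satisfying the linearized system exist. *)

(* Defs.v *)
From HB Require Import structures.
From mathcomp Require Import all_boot all_order all_algebra.
From mathcomp Require Import boolp classical_sets cardinality reals numfun convex.

Set Implicit Arguments.
Unset Strict Implicit.
Unset Printing Implicit Defensive.

Import Order.TTheory GRing.Theory Num.Theory.

Local Open Scope classical_set_scope.
Local Open Scope ring_scope.

Section Convexity.
Context {R : realType}.

Definition conv_hull {M : lmodType R} (A : set M) : set M :=
  smallest (@convex_set R M) A.

Definition polytope {M : lmodType R} (P : set M) : Prop :=
  exists2 V : set M, finite_set V & P = conv_hull V.

(* A cone contains the origin; without this, constraints multiplied by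
   gamma = 0 would not be void. *)
Definition convex_cone {M : lmodType R} (K : set M) : Prop :=
  [/\ convex_set K, K 0 & forall (t : R) a, 0 <= t -> K a -> K (t *: a)].

Definition le_cone {M : lmodType R} (K : set M) (a a' : M) : Prop := K (a' - a).

(* The multiple g P, with the convention 0 P = {0} even when P is empty. *)
Definition dilate {M : lmodType R} (g : R) (P : set M) : set M :=
  [set v | if g == 0 then v = 0 else exists2 p, P p & v = g *: p].

Definition dot {d : nat} (p x : 'cV[R]_d) : R := (p^T *m x) ord0 ord0.

Definition valid_ineq {d : nat} (A : set 'cV[R]_d) (t : R) (p : 'cV[R]_d) :
  Prop := forall x, A x -> 0 <= t - dot p x.

Definition face_of {d : nat} (A F : set 'cV[R]_d) : Prop :=
  exists (t : R) (p : 'cV[R]_d),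
    valid_ineq A t p /\ F = [set x | A x /\ t - dot p x = 0].

(* a vertex is a zero-dimensional face *)
Definition vertex {d : nat} (A : set 'cV[R]_d) (v : 'cV[R]_d) : Prop :=
  face_of A [set v].

End Convexity.

Section FacialDisjunctive.
(* Indices are numbered from 0: i : 'I_np, and F i 0, ..., F i (j i - 1). *)
Context {R : realType} {np : nat} {n : 'I_np -> nat} {ny mk : nat}
  {j : 'I_np -> nat}.

Local Notation X := 'cV[R]_(\sum_(i < np) n i).
Local Notation Y := 'cV[R]_ny.

Variables (K : set 'cV[R]_mk)
  (B : 'M[R]_(mk, \sum_(i < np) n i)) (D : 'M[R]_(mk, ny)) (c : 'cV[R]_mk).
Variables (P : forall i : 'I_np, set 'cV[R]_(n i))
  (F : forall i : 'I_np, 'I_(j i) -> set 'cV[R]_(n i)).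
Variables (tau : forall i : 'I_np, 'I_(j i) -> R)
  (piv : forall i : 'I_np, 'I_(j i) -> 'cV[R]_(n i)).

Definition FD : set (X * Y) :=
  [set z | le_cone K (B *m z.1 + D *m z.2) c /\
    forall i, (\bigcup_a F (i := i) a) (submxcol z.1 i)].

(* J^S: dependent functions on the subtype of the i in S. *)
Definition J (S : {set 'I_np}) : finType :=
  {dffun forall i : {i : 'I_np | i \in S}, 'I_(j (val i))}.

Definition FS (S : {set 'I_np}) (s : J S) : set X :=
  [set x |
    (forall i : {i : 'I_np | i \in S}, F (s i) (submxcol x (val i))) /\
    (forall i, i \notin S -> (\bigcup_a F (i := i) a) (submxcol x i))].

Definition stack (t : R) (x : X) (y : Y) : 'cV[R]_(1 + (\sum_(i < np) n i + ny)) :=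
  col_mx t%:M (col_mx x y).

(* In both systems the variables are indexed by all S, but only those with
   #|S| = k are constrained. *)
Definition FDR_system (k : nat) (x : X) (y : Y)
    (g : forall S : {set 'I_np}, J S -> R) : Prop :=
  forall S : {set 'I_np}, #|S| = k ->
  [/\ forall s : J S, le_cone K (g S s *: (- c + B *m x + D *m y)) 0,
      \sum_(s : J S) g S s *: stack 1 x y = stack 1 x y,
      forall (s : J S) (i' : 'I_np),
        dilate (g S s) (P (i := i')) (g S s *: submxcol x i'),
      forall (i : {i : 'I_np | i \in S}) (s : J S),
        g S s * (tau (s i) - dot (piv (s i)) (submxcol x (val i))) <= 0
    & forall s : J S, 0 <= g S s].

Definition FDR (k : nat) : set (X * Y) :=
  [set z | exists g, FDR_system k z.1 z.2 g].

Definition FDR_indicator (k : nat) : set (X * Y) :=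
  [set z | FDR_system k z.1 z.2 (fun S s => \1_(FS s) z.1)].

Definition LFDR_system (k : nat) (x : X) (y : Y)
    (g : forall S : {set 'I_np}, J S -> R)
    (u : forall S : {set 'I_np}, J S -> X)
    (w : forall S : {set 'I_np}, J S -> Y) : Prop :=
  forall S : {set 'I_np}, #|S| = k ->
  [/\ forall s : J S,
        le_cone K (- (g S s *: c) + B *m u S s + D *m w S s) 0,
      \sum_(s : J S) stack (g S s) (u S s) (w S s) = stack 1 x y,
      forall (s : J S) (i' : 'I_np),
        dilate (g S s) (P (i := i')) (submxcol (u S s) i'),
      forall (i : {i : 'I_np | i \in S}) (s : J S),
        g S s * tau (s i) - dot (piv (s i)) (submxcol (u S s) (val i)) <= 0
    & forall s : J S, 0 <= g S s].

Definition LFDR (k : nat) : set (X * Y) :=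
  [set z | exists g u w, LFDR_system k z.1 z.2 g u w].

End FacialDisjunctive.

(* Main.v *)
Require Import Defs.
From mathcomp Require Import all_boot all_order all_algebra.
From mathcomp Require Import boolp classical_sets cardinality reals numfun convex.
From mathcomp Require Import interval_inference ring lra.

(** For fixed S and s, the constraints that the linearized system puts on
    (gamma^{S,s}, u^{S,s}, w^{S,s}) are homogeneous: dilates of a convex set
    satisfy g P + h P = (g + h) P for g, h >= 0, also with 0 P = {0}, so the
    triples satisfying them form a convex cone ([hom_piece]).  The nonlinear
    system asks that the particular triple (g, g x, g y) lie in this cone, so
    it is contained in its linearization ([FDR_systemE], [FDR_sub_LFDR]).

    If z solves the nonlinear system and |S| = k, the multipliers of S sum to
    1, hence one of them is positive; dividing by it shows that z satisfies the
    conic constraint and that x_i lies in some F_ij for each i in S.  Each i is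
    in a set S of size k, so z is in FD ([FDR_sub_FD]).  Conversely, for z in FD
    and disjoint faces, exactly one s in J^S has z in F^{S,s}, so the indicators
    of the F^{S,s} are valid multipliers ([FD_sub_FDR_indicator]).

    From level k + 1 to level k, choose for each S of size k a superset T of
    size k + 1 and add up the triples of T over the fibres of the restriction map
    from J^T to J^S ([LFDR_mono]).

    At the last level only the full index set S matters.  Every triple with a
    positive multiplier g is g (1; z_s) with z_s in FD.  A triple with g = 0 has
    the form (0; 0; w) with - D w in K, since 0 P_i = {0}: it need not vanish,
    but it is a recession direction of FD, so adding it maps FD, and therefore
    conv(FD), into itself ([FD_recession], [conv_hull_shift]).  Hence z, the sum
    of all the triples, is in conv(FD) ([LFDR_top_sub_conv]).  The other
    inclusion holds because the linear relaxations are convex and contain FD. *)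

Import Order.TTheory GRing.Theory Num.Theory.
Local Open Scope classical_set_scope.
Local Open Scope ring_scope.

(** * Convex sets, convex hulls and dilates *)

Section Convexity.
Set Implicit Arguments.
Unset Strict Implicit.
Context {R : realType} {M : lmodType R}.
Implicit Types (A P : set M) (v w : M).

Lemma convex_setP A :
  convex_set A <-> forall (t : R) v w, 0 <= t -> t <= 1 -> A v -> A w ->
    A (t *: v + (1 - t) *: w).
Proof.
split=> [cA t v w t0 t1 Av Aw|cA v w t /set_mem Av /set_mem Aw].
  exact: (set_mem (cA v w (Itv01 t0 t1) (mem_set Av) (mem_set Aw))).
by apply: mem_set; apply: cA.
Qed.

Lemma conv_hull_convex A : convex_set (conv_hull A).
Proof.
apply/convex_setP => t v w t0 t1 Av Aw C [cC AC].
have /convex_setP := cC; apply=> //; [exact: Av|exact: Aw].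
Qed.

Lemma polytope_convex P : polytope P -> convex_set P.
Proof. by case=> V _ ->; apply: conv_hull_convex. Qed.

(** Closure of convex sets under finite convex combinations with positive
    weights. *)
Lemma convex_sum A (I : finType) (Q : pred I) (t : I -> R) (p : I -> M) :
  convex_set A -> (forall i, Q i -> 0 < t i /\ A (p i)) ->
  \sum_(i | Q i) t i = 1 -> A (\sum_(i | Q i) t i *: p i).
Proof.
move=> /convex_setP cA Qp sum1.
(* Induction over partial sums, normalized by their total weight T. *)
suff aux (r : seq I) : let T := \sum_(i <- r | Q i) t i in
    0 <= T /\ (0 < T -> A (T^-1 *: \sum_(i <- r | Q i) t i *: p i)).
  by have [_] := aux (index_enum I); rewrite sum1 invr1 scale1r; apply.
elim: r => [|i r /= [T0 IH]]; first by rewrite /= !big_nil ltxx.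
rewrite /= !big_cons; case: ifP => // /Qp[ti0 Api].
set T := \sum_(k <- r | Q k) t k in T0 IH *.
set p' := \sum_(k <- r | Q k) t k *: p k in IH *.
have TT : 0 < t i + T by rewrite ltr_wpDr.
split=> [|_]; first exact: ltW.
have [T00|T00] := eqVneq T 0; last first.
  have {}T0 : 0 < T by rewrite lt_neqAle eq_sym T00.
  have -> : (t i + T)^-1 *: (t i *: p i + p') =
      (t i / (t i + T)) *: p i + (1 - t i / (t i + T)) *: (T^-1 *: p').
    rewrite scalerDr !scalerA; congr (_ *: _ + _ *: _).
      by rewrite mulrC.
    by field; rewrite ?gt_eqF //=.
  apply: cA => //; last exact: IH.
    by rewrite divr_ge0 // ltW.
  by rewrite ler_pdivrMr // mul1r lerDl ltW.
(* T = 0 with positive weights: no index of r satisfies Q. *)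
have -> : p' = 0.
  apply: big1_seq => k /andP[Qk kr].
  exfalso; have [tk _] := Qp _ Qk; move: T00.
  rewrite /T (perm_big _ (perm_to_rem kr)) /= big_cons Qk.
  apply/eqP; rewrite gt_eqF // ltr_wpDr // sumr_ge0 // => l /Qp[tl _].
  exact: ltW.
by rewrite T00 !addr0 scalerA mulVf ?scale1r // gt_eqF.
Qed.

(** Translations mapping A into itself map its convex hull into itself. *)
Lemma conv_hull_shift A v : (forall w, A w -> A (w + v)) ->
  forall w, conv_hull A w -> conv_hull A (w + v).
Proof.
move=> Av; apply: smallest_sub => [|w Aw]; last first.
  by apply: sub_gen_smallest; apply: Av.
apply/convex_setP => t a b t0 t1 ha hb /=.
have /convex_setP /(_ t _ _ t0 t1 ha hb) := @conv_hull_convex A.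
by rewrite !scalerDr addrACA -scalerDl addrC subrKC scale1r addrC.
Qed.

Lemma dilateD P (g h : R) v w : convex_set P -> 0 <= g -> 0 <= h ->
  dilate g P v -> dilate h P w -> dilate (g + h) P (v + w).
Proof.
move=> /convex_setP cP g0 h0; rewrite /dilate /=.
have [->|gn0] := eqVneq g 0; first by rewrite add0r => ->; rewrite add0r.
have [->|hn0] := eqVneq h 0; first by move=> gv ->; rewrite !addr0 (negPf gn0).
have gp : 0 < g by rewrite lt_neqAle eq_sym gn0.
have hp : 0 < h by rewrite lt_neqAle eq_sym hn0.
have ghp : 0 < g + h by rewrite addr_gt0.
rewrite (gt_eqF ghp) => -[p Pp ->] [q Pq ->].
exists ((g / (g + h)) *: p + (1 - g / (g + h)) *: q).
  apply: cP => //; first by rewrite divr_ge0 // ltW.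
  by rewrite ler_pdivrMr // mul1r lerDl.
rewrite scalerDr !scalerA; by congr (_ *: _ + _ *: _); field; rewrite gt_eqF.
Qed.

Lemma dilateZ P (t g : R) v : dilate g P v -> dilate (t * g) P (t *: v).
Proof.
rewrite /dilate /= mulf_eq0.
have [->|tn0] := eqVneq t 0; first by rewrite scale0r.
have [_ ->|gn0 [p Pp ->]] /= := eqVneq g 0; first by rewrite scaler0.
by exists p => //; rewrite scalerA.
Qed.

Lemma convex_coneD (K : set M) v w : convex_cone K -> K v -> K w -> K (v + w).
Proof.
move=> [/convex_setP cK _ KZ] Kv Kw.
(* v + w is twice the midpoint of v and w. *)
have h : 2^-1 <= 1 :> R by lra.
have /(KZ 2) := cK 2^-1 _ _ ltac:(by rewrite invr_ge0) h Kv Kw.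
have -> : 1 - 2^-1 = 2^-1 :> R by field.
by rewrite -scalerDr scalerA divff ?pnatr_eq0 // scale1r; apply.
Qed.

End Convexity.

Lemma dotDr (R : realType) d (p x y : 'cV[R]_d) :
  dot p (x + y) = dot p x + dot p y.
Proof. by rewrite /dot mulmxDr mxE. Qed.

Lemma dotZr (R : realType) d (p x : 'cV[R]_d) t : dot p (t *: x) = t * dot p x.
Proof. by rewrite /dot -scalemxAr mxE. Qed.

(** * The constraints on a single multiplier *)

Lemma exists_notin (np : nat) (S : {set 'I_np}) :
  (#|S| < np)%N -> exists i, i \notin S.
Proof.
move=> Snp; apply/existsP; rewrite -negb_forall; apply: contraL Snp.
move=> /forallP allS; have -> : S = [set: 'I_np]%SET.
  by apply/setP => i; rewrite inE allS.
by rewrite cardsT card_ord ltnn.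
Qed.

Section FacialDisjunctive.
Set Implicit Arguments.
Unset Strict Implicit.
Context {R : realType} {np : nat} {n : 'I_np -> nat} {ny mk : nat}
  {j : 'I_np -> nat}.

Local Notation X := 'cV[R]_(\sum_(i < np) n i).
Local Notation Y := 'cV[R]_ny.

Lemma submxcolZ (t : R) (x : X) i : submxcol (t *: x) i = t *: submxcol x i.
Proof. by apply/matrixP => a b; rewrite !mxE. Qed.

Lemma stackZ t g (x : X) (y : Y) :
  t *: stack g x y = stack (t * g) (t *: x) (t *: y).
Proof. by rewrite /stack !scale_col_mx scale_scalar_mx. Qed.

Lemma stackD g h (x x' : X) (y y' : Y) :
  stack g x y + stack h x' y' = stack (g + h) (x + x') (y + y').
Proof. by rewrite /stack !add_col_mx raddfD. Qed.

Lemma stack0 : stack 0 (0 : X) (0 : Y) = 0.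
Proof. by rewrite /stack raddf0 !col_mx0. Qed.

Lemma stack_inj g h (x x' : X) (y y' : Y) :
  stack g x y = stack h x' y' -> [/\ g = h, x = x' & y = y'].
Proof.
rewrite /stack => /eq_col_mx[gh /eq_col_mx[-> ->]]; split=> //.
by have /matrixP/(_ 0 0) := gh; rewrite !mxE eqxx !mulr1n.
Qed.

Lemma stack_sum (I : finType) (Q : pred I) (g : I -> R) (u : I -> X)
    (w : I -> Y) :
  \sum_(i | Q i) stack (g i) (u i) (w i) =
  stack (\sum_(i | Q i) g i) (\sum_(i | Q i) u i) (\sum_(i | Q i) w i).
Proof.
elim: (index_enum I) => [|i r IH]; first by rewrite !big_nil stack0.
by rewrite !big_cons; case: ifP => // _; rewrite IH stackD.
Qed.

(** The restriction map from J^T to J^S, for S a subset of T. *)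
Definition restr (S T : {set 'I_np}) (ST : S \subset T) (t : J (j := j) T) :
    J (j := j) S :=
  [ffun i => t (Sub (val i) (fintype.subsetP ST _ (valP i)))].

(** The element of J^S induced by a choice of one face for each index. *)
Definition choices (a : forall i, 'I_(j i)) (S : {set 'I_np}) : J (j := j) S :=
  [ffun i => a (val i)].

Variables (K : set 'cV[R]_mk)
  (B : 'M[R]_(mk, \sum_(i < np) n i)) (D : 'M[R]_(mk, ny)) (c : 'cV[R]_mk).
Variables (P : forall i : 'I_np, set 'cV[R]_(n i))
  (F : forall i : 'I_np, 'I_(j i) -> set 'cV[R]_(n i)).
Arguments P : clear implicits.
Variables (tau : forall i : 'I_np, 'I_(j i) -> R)
  (piv : forall i : 'I_np, 'I_(j i) -> 'cV[R]_(n i)).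

(** The constraints of the linearized system on a single triple
    (g, u, w) = (gamma^{S,s}, u^{S,s}, w^{S,s}); the only other constraint is
    the one that sums over s. *)
Definition hom_piece (S : {set 'I_np}) (s : J S) (g : R) (u : X) (w : Y) :
    Prop :=
  [/\ le_cone K (- (g *: c) + B *m u + D *m w) 0,
      forall i, dilate g (P i) (submxcol u i),
      forall i : {i : 'I_np | i \in S},
        g * tau (s i) - dot (piv (s i)) (submxcol u (val i)) <= 0
    & 0 <= g].

Lemma LFDR_systemE k x y g u w : LFDR_system K B D c P tau piv k x y g u w <->
  forall S : {set 'I_np}, #|S| = k ->
    (forall s : J S, hom_piece s (g S s) (u S s) (w S s)) /\
    \sum_(s : J S) stack (g S s) (u S s) (w S s) = stack 1 x y.
Proof.
split=> sys S Sk; first by have [? ? ? ? ?] := sys S Sk; split=> // s; split.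
have [pieces sums] := sys S Sk.
by split=> // [s|s i|i s|s]; have [? ? ? ?] := pieces s.
Qed.

(** The nonlinear system is the linearized one at u = g x and w = g y. *)
Lemma FDR_systemE k x y g : FDR_system K B D c P tau piv k x y g <->
  forall S : {set 'I_np}, #|S| = k ->
    (forall s : J S, hom_piece s (g S s) (g S s *: x) (g S s *: y)) /\
    \sum_(s : J S) stack (g S s) (g S s *: x) (g S s *: y) = stack 1 x y.
Proof.
have eqK h : h *: (- c + B *m x + D *m y)
    = - (h *: c) + B *m (h *: x) + D *m (h *: y).
  by rewrite !scalerDr scalerN !scalemxAr.
have eqS S : \sum_(s : J S) stack (g S s) (g S s *: x) (g S s *: y) =
    \sum_(s : J S) g S s *: stack 1 x y.
  by apply: eq_bigr => s _; rewrite stackZ mulr1.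
split=> sys S Sk.
  have [h1 h2 h3 h4 h5] := sys S Sk; rewrite eqS; split=> // s; split=> //.
  - by rewrite -eqK.
  - by move=> i; rewrite submxcolZ.
  - by move=> i; rewrite submxcolZ dotZr -mulrBr.
have [pieces sums] := sys S Sk; rewrite -eqS.
split=> // [s|s i|i s|s]; have [h1 h2 h3 h4] := pieces s => //.
- by rewrite eqK.
- by rewrite -submxcolZ.
- by rewrite mulrBr -dotZr -submxcolZ.
Qed.

Lemma FDR_sub_LFDR k :
  FDR K B D c P tau piv k `<=` LFDR K B D c P tau piv k.
Proof.
move=> z [g /FDR_systemE sys].
exists g, (fun S s => g S s *: z.1), (fun S s => g S s *: z.2).
exact/LFDR_systemE.
Qed.

(** ** The cone of feasible triples *)

Hypothesis K_cone : convex_cone K.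
Hypothesis P_convex : forall i, convex_set (P i).

Section Piece.
Variables (S : {set 'I_np}) (s : J (j := j) S).

Lemma hom_piece0 : hom_piece s 0 0 0.
Proof.
split=> [|i|i|//].
- by rewrite /le_cone scale0r !mulmx0 !addr0 oppr0 subr0; case: K_cone.
- by rewrite submxcol0 /dilate /= eqxx.
- by rewrite submxcol0 -(scale0r 0) dotZr !mul0r subr0.
Qed.

Lemma hom_pieceD g h u u' w w' : hom_piece s g u w -> hom_piece s h u' w' ->
  hom_piece s (g + h) (u + u') (w + w').
Proof.
case=> [k1 d1 t1 g1] [k2 d2 t2 g2]; split; last exact: addr_ge0.
- have := convex_coneD K_cone k1 k2; rewrite /le_cone !sub0r -opprD.
  by rewrite addrACA [X in X + _]addrACA -opprD -scalerDl -!mulmxDr.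
- by move=> i; rewrite submxcolD; apply: dilateD.
- move=> i; rewrite submxcolD dotDr mulrDl opprD addrACA.
  by rewrite -[leRHS]addr0 lerD.
Qed.

Lemma hom_pieceZ t g u w : 0 <= t -> hom_piece s g u w ->
  hom_piece s (t * g) (t *: u) (t *: w).
Proof.
move=> t0 [k1 d1 t1 g1]; split; last exact: mulr_ge0.
- case: K_cone => _ _ /(_ t _ t0 k1); rewrite /le_cone; congr K.
  by rewrite !sub0r scalerN !scalerDr scalerN scalerA !scalemxAr.
- by move=> i; rewrite submxcolZ; apply: dilateZ.
- by move=> i; rewrite submxcolZ dotZr -mulrA -mulrBr mulr_ge0_le0.
Qed.

Lemma hom_piece_sum (I : finType) (Q : pred I) g u w :
  (forall i, Q i -> hom_piece s (g i) (u i) (w i)) ->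
  hom_piece s (\sum_(i | Q i) g i) (\sum_(i | Q i) u i) (\sum_(i | Q i) w i).
Proof.
move=> Qi; elim: (index_enum I) => [|i r IH].
  by rewrite !big_nil; apply: hom_piece0.
by rewrite !big_cons; case: ifP => // /Qi; move/hom_pieceD; apply.
Qed.

(** Here the convention 0 P = {0} is used: it bounds u, but w may still be any
    vector with - D w in K. *)
Lemma hom_piece_eq0 u w : hom_piece s 0 u w -> u = 0 /\ K (- (D *m w)).
Proof.
case=> [k d _ _]; suff u0 : u = 0.
  by split=> //; move: k; rewrite /le_cone u0 scale0r mulmx0 oppr0 !add0r.
apply/mxcolP => i; rewrite submxcol0.
by have := d i; rewrite /dilate /= eqxx.
Qed.

End Piece.

Lemma hom_piece_restr (S T : {set 'I_np}) (ST : S \subset T) (t : J T) g u w :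
  hom_piece t g u w -> hom_piece (restr ST t) g u w.
Proof.
case=> [k d h g0]; split=> // i; rewrite ffunE.
exact: (h (Sub (val i) (fintype.subsetP ST _ (valP i)))).
Qed.

(** * Inclusions between the relaxations *)

Lemma LFDR_mono k : (k < np)%N ->
  LFDR K B D c P tau piv k.+1 `<=` LFDR K B D c P tau piv k.
Proof.
move=> k_np z [g [u [w /LFDR_systemE sys]]].
(* For S of another size T is irrelevant, and T = S makes the choice total. *)
have ext (S : {set 'I_np}) : exists T : {set 'I_np},
    S \subset T /\ (#|S| = k -> #|T| = k.+1).
  have [Sk|] := eqVneq #|S| k; last by move=> /eqP Sk; exists S.
  have [i iS] := exists_notin (S := S) ltac:(by rewrite Sk).
  by exists (i |: S); rewrite subsetU1 cardsU1 iS Sk.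
have {ext} [e eP] := choice ext.
pose r (S : {set 'I_np}) : J (e S) -> J S := restr (proj1 (eP S)).
exists (fun S s => \sum_(t | r S t == s) g (e S) t),
  (fun S s => \sum_(t | r S t == s) u (e S) t),
  (fun S s => \sum_(t | r S t == s) w (e S) t).
apply/LFDR_systemE => S /(proj2 (eP S)) /sys[pieces sums]; split=> [s|].
  by apply: hom_piece_sum => t /eqP <-; apply: hom_piece_restr.
rewrite -sums (partition_big (r S) xpredT) //.
by apply: eq_bigr => s _; rewrite -stack_sum.
Qed.

Lemma LFDR_convex k : convex_set (LFDR K B D c P tau piv k).
Proof.
apply/convex_setP => t a b t0 t1 [g [u [w /LFDR_systemE sysa]]].
move=> [h [u' [w' /LFDR_systemE sysb]]].
exists (fun S s => t * g S s + (1 - t) * h S s),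
  (fun S s => t *: u S s + (1 - t) *: u' S s),
  (fun S s => t *: w S s + (1 - t) *: w' S s).
apply/LFDR_systemE => S Sk.
have [pa sa] := sysa S Sk; have [pb sb] := sysb S Sk; split=> [s|].
  by apply: hom_pieceD; apply: hom_pieceZ => //; rewrite subr_ge0.
under [LHS]eq_bigr do rewrite -stackD -!stackZ.
rewrite [LHS]big_split /= -!scaler_sumr sa sb !stackZ stackD !mulr1.
by rewrite addrC subrK.
Qed.

Hypothesis F_def : forall i (a : 'I_(j i)),
  F a = [set x | P i x /\ tau a - dot (piv a) x <= 0].

(** A triple with a positive multiplier is that multiple of a point that
    satisfies the conic constraint and lies in the faces selected by s. *)
Lemma hom_piece_gt0 (S : {set 'I_np}) (s : J S) g u w :
  0 < g -> hom_piece s g u w ->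
  le_cone K (B *m (g^-1 *: u) + D *m (g^-1 *: w)) c /\
  forall i : {i : 'I_np | i \in S}, F (s i) (submxcol (g^-1 *: u) (val i)).
Proof.
move=> g0 /(hom_pieceZ (t := g^-1)); rewrite invr_ge0 (ltW g0) => /(_ isT).
rewrite mulVf ?gt_eqF // => -[k d h _]; split.
  move: k; rewrite /le_cone sub0r scale1r; congr K.
  by rewrite !opprD opprK addrA.
move=> i; rewrite F_def; split; last by have := h i; rewrite mul1r.
have := d (val i); rewrite /dilate /= oner_eq0 => -[p Pp ->].
by rewrite scale1r.
Qed.

Lemma hom_piece_point (S : {set 'I_np}) (a : forall i, 'I_(j i)) x y :
  le_cone K (B *m x + D *m y) c -> (forall i, F (a i) (submxcol x i)) ->
  hom_piece (choices a S) 1 x y.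
Proof.
move=> k Fx; split=> // [|i|i].
- move: k; rewrite /le_cone; congr K.
  by rewrite sub0r scale1r !opprD opprK addrA.
- rewrite /dilate /= oner_eq0; exists (submxcol x i); last by rewrite scale1r.
  by have := Fx i; rewrite F_def => -[].
- by rewrite ffunE mul1r; have := Fx (val i); rewrite F_def => -[].
Qed.

Lemma FDR_sub_FD k : (1 <= k <= np)%N ->
  FDR K B D c P tau piv k `<=` FD K B D c F.
Proof.
move=> /andP[k1 kn] z [g /FDR_systemE sys].
have active (S : {set 'I_np}) : #|S| = k -> le_cone K (B *m z.1 + D *m z.2) c /\
    exists s : J S, forall i, F (s i) (submxcol z.1 (val i)).
  move=> /sys[pieces]; rewrite stack_sum => /stack_inj[g1 _ _].
  have [s gs0] : exists s, g S s != 0.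
    apply/existsP; rewrite -[X in is_true X]negbK negb_exists.
    apply/negP => /forallP gs0.
    move: g1; rewrite big1 => [/esym/eqP|s _]; first by rewrite oner_eq0.
    by apply/eqP; have := gs0 s; rewrite negbK.
  have gs : 0 < g S s by rewrite lt_neqAle eq_sym gs0; case: (pieces s).
  have := hom_piece_gt0 gs (pieces s).
  by rewrite !scalerA mulVf // !scale1r => -[? ?]; split=> //; exists s.
have cover i : exists2 S : {set 'I_np}, i \in S & #|S| = k.
  elim: k k1 kn {sys active} => // -[_ _ _|k IH _ kn].
    by exists [set i]%SET; rewrite ?set11 ?cards1.
  have [S iS Sk] := IH isT (ltnW kn).
  have [l lS] := exists_notin (S := S) ltac:(by rewrite Sk).
  by exists (l |: S); rewrite ?inE ?iS ?orbT // cardsU1 lS Sk.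
(* Any index yields a set S of size k, hence the conic constraint. *)
have i0 : 'I_np by exists 0%N; apply: leq_trans kn.
split; first by have [S _ /active[]] := cover i0.
move=> i; have [S iS /active[_ [s Fs]]] := cover i.
by exists (s (Sub i iS)) => //; apply: (Fs (Sub i iS)).
Qed.

Hypothesis F_disjoint :
  forall i (a b : 'I_(j i)), a <> b -> F a `&` F b = set0.

Lemma FD_sub_FDR_indicator k :
  FD K B D c F `<=` FDR_indicator K B D c P F tau piv k.
Proof.
move=> z [kz Fz].
have {}Fz i : exists a : 'I_(j i), F a (submxcol z.1 i).
  by have [a _ Fa] := Fz i; exists a.
pose a i := projT1 (cid (Fz i)).
have Fa i : F (a i) (submxcol z.1 i) by exact: (projT2 (cid (Fz i))).
have indic S (s : J S) : \1_(FS F s) z.1 = (s == choices a S)%:R :> R.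
  rewrite indicE; congr (_%:R); congr nat_of_bool.
  apply/idP/eqP => [/set_mem[Fs _]|->].
    apply/ffunP => i; rewrite ffunE; apply: contrapT => sa.
    have : (F (s i) `&` F (a (val i))) (submxcol z.1 (val i)) by split.
    by rewrite F_disjoint.
  apply: mem_set; split=> [i|i _]; first by rewrite ffunE.
  by exists (a i).
apply/FDR_systemE => S Sk; split=> [s|].
  rewrite indic; case: eqVneq => [->|_].
    by rewrite !scale1r; apply: hom_piece_point.
  by rewrite !scale0r; apply: hom_piece0.
rewrite (bigD1 (choices a S)) //= indic eqxx !scale1r.
rewrite [X in _ + X]big1 ?addr0 // => s /negPf sa.
by rewrite indic sa !scale0r stack0.
Qed.

(** * The last level *)

Lemma FD_recession (v : X * Y) : v.1 = 0 -> K (- (D *m v.2)) ->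
  forall z, FD K B D c F z -> FD K B D c F (z + v).
Proof.
case: v => _ y /= -> Ky [x y'] [kz Fz]; split=> [|i] /=; rewrite addr0 //.
have := convex_coneD K_cone kz Ky; congr K.
by rewrite /= mulmxDr !opprD !addrA.
Qed.

Lemma LFDR_top_sub_conv :
  LFDR K B D c P tau piv np `<=` conv_hull (FD K B D c F).
Proof.
move=> z [g [u [w /LFDR_systemE/(_ [set: 'I_np]%SET)]]].
rewrite cardsT card_ord => /(_ erefl).
move: (g _) (u _) (w _) => {}g {}u {}w [pieces].
rewrite stack_sum => /stack_inj[g1 u1 w1].
have {}g1 : \sum_(s | g s != 0) g s = 1.
  by rewrite big_mkcond -[RHS]g1; apply: eq_bigr => s _; case: eqP.
(* The total contribution of the triples with multiplier 0. *)
pose zero := \sum_(s | g s == 0) ((u s, w s) : X * Y).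
have -> : z = \sum_(s | g s != 0)
    g s *: (((g s)^-1 *: u s, (g s)^-1 *: w s) : X * Y) + zero.
  have -> : z = (\sum_s u s, \sum_s w s) by rewrite u1 w1; case: (z).
  have -> : (\sum_s u s, \sum_s w s) = \sum_s ((u s, w s) : X * Y).
    elim: (index_enum (J _)) => [|s r IH]; first by rewrite !big_nil.
    by rewrite !big_cons -IH.
  rewrite (bigID (fun s => g s == 0)) /= addrC; congr (_ + _).
  by apply: eq_bigr => s gs; congr pair; rewrite scalerA divff ?scale1r.
have [zero1 Kzero] : zero.1 = 0 /\ K (- (D *m zero.2)).
  apply: (big_ind (fun v : X * Y => v.1 = 0 /\ K (- (D *m v.2)))).
  - by rewrite mulmx0 oppr0; case: K_cone.
  - move=> v v' [v1 Kv] [v'1 Kv'].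
    by rewrite /= v1 v'1 addr0 mulmxDr opprD; split=> //; apply: convex_coneD.
  - move=> s /eqP gs; apply: (hom_piece_eq0 (s := s)).
    by have := pieces s; rewrite gs.
apply: conv_hull_shift; first by move=> v; apply: FD_recession.
apply: convex_sum => //; first exact: conv_hull_convex.
move=> s gs0.
have gs : 0 < g s by rewrite lt_neqAle eq_sym gs0; case: (pieces s).
split=> //; have [k Fs] := hom_piece_gt0 gs (pieces s).
apply: sub_gen_smallest; split=> // i.
pose i' : {i | i \in [set: 'I_np]%SET} := Sub i (finset.in_setT i).
by exists (s i') => //; apply: (Fs i').
Qed.

End FacialDisjunctive.

Theorem theorem6 (R : realType) (np : nat) (n : 'I_np -> nat) (ny mk : nat)
  (j : 'I_np -> nat)
  (K : set 'cV[R]_mk)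
  (B : 'M[R]_(mk, \sum_(i < np) n i)) (D : 'M[R]_(mk, ny)) (c : 'cV[R]_mk)
  (P : forall i : 'I_np, set 'cV[R]_(n i))
  (F : forall i : 'I_np, 'I_(j i) -> set 'cV[R]_(n i))
  (tau : forall i : 'I_np, 'I_(j i) -> R)
  (piv : forall i : 'I_np, 'I_(j i) -> 'cV[R]_(n i))
  (np_gt0 : (0 < np)%N)
  (K_cone : convex_cone K)
  (P_polytope : forall i, polytope (P i))
  (F_face : forall i (a : 'I_(j i)), face_of (P i) (F i a))
  (F_disjoint : forall i (a b : 'I_(j i)), a <> b -> F i a `&` F i b = set0)
  (valid : forall i (a : 'I_(j i)), valid_ineq (P i) (tau i a) (piv i a))
  (F_def : forall i (a : 'I_(j i)),
     F i a = [set x | P i x /\ tau i a - dot (piv i a) x <= 0]) :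
  [/\ (* FDR^k is a relaxation of FD *)
      forall k, (1 <= k <= np)%N ->
        FD K B D c F `<=` FDR K B D c P tau piv k,
      (* the multipliers can be restricted to be indicators *)
      (forall i (a b : 'I_(j i)), a <> b ->
         forall v, ~ (vertex (F i a) v /\ vertex (F i b) v)) ->
      forall k, (1 <= k <= np)%N ->
        FDR_indicator K B D c P F tau piv k = FDR K B D c P tau piv k,
      (* the linear system relaxes the nonlinear one *)
      forall k, (1 <= k <= np)%N ->
        FDR K B D c P tau piv k `<=` LFDR K B D c P tau piv k,
      (* the chain of linear relaxations *)
      forall k, (1 <= k < np)%N ->
        LFDR K B D c P tau piv k.+1 `<=` LFDR K B D c P tau piv k
    & LFDR K B D c P tau piv np = conv_hull (FD K B D c F)].
Proof.
have Pc i := polytope_convex (P_polytope i).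
have ind_sub k :
    FDR_indicator K B D c P F tau piv k `<=` FDR K B D c P tau piv k.
  by move=> z sys; exists (fun S s => \1_(FS F s) z.1).
have FD_sub_ind k : FD K B D c F `<=` FDR_indicator K B D c P F tau piv k.
  exact: FD_sub_FDR_indicator.
have FD_sub k := subset_trans (FD_sub_ind k) (ind_sub k).
split.
- by move=> k _; apply: FD_sub.
- move=> _ k kn; apply/seteqP; split; first exact: ind_sub.
  exact: subset_trans (FDR_sub_FD K_cone F_def kn) (FD_sub_ind k).
- by move=> k _; apply: FDR_sub_LFDR.
- by move=> k /andP[_ kn]; apply: LFDR_mono.
- apply/seteqP; split; first exact: LFDR_top_sub_conv.
  apply: smallest_sub; first exact: LFDR_convex.
  exact: subset_trans (FD_sub np) (FDR_sub_LFDR (k := np)).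
Qed.
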